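(* Consider an $L$-layer CNN (as defined in the context) whose nonlinearity $\sigma:\mathbb{R}\to\mathbb{R}$ is non-expansive, i.e. $|\sigma(s)-\sigma(t)|\le|s-t|$ for all $s,t\in\mathbb{R}$. For $l=1,\dots,L$ let $$B_l := \max\Big\{ \sup_{\lambda\in[M_l]} \sum_{\lambda'=1}^{M_{l-1}} \| W^{(l)}_{\lambda',\lambda}\|_1,\ \sup_{\lambda'\in[M_{l-1}]} \frac{M_{l-1}}{M_l}\sum_{\lambda=1}^{M_l}\| W^{(l)}_{\lambda',\lambda}\|_1 \Big\}.$$ Suppose $B_l\le 1$ for all $l$. Then: (a) For every $l$, the mapping of the $l$-th convolutional layer (including $\sigma$), $x^{(l-1)}\mapsto x^{(l)}[x^{(l-1)}]$, is non-expansive: $\| x^{(l)}[x_1]-x^{(l)}[x_2]\|\le\|x_1-x_2\|$ for arbitrary $x_1,x_2$. (b) For every $l$, $\|x_c^{(l)}\|\le\|x_c^{(l-1)}\|$, where $x_c^{(l)}(u,\lambda)=x^{(l)}(u,\lambda)-x_0^{(l)}(\lambda)$ is the centered version of $x^{(l)}$ and $x_0^{(l)}$ is the output at the $l$-th layer produced by the zero input at the bottom layer. As a result, $\|x_c^{(l)}\|\le\|x_c^{(0)}\|=\|x^{(0)}\|$.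
   Context: Write $[M]=\{1,\dots,M\}$. A CNN with $L$ layers and channel numbers $M_0,\dots,M_L\ge1$ maps an input $x^{(0)}(u,\lambda)$, $u\in\mathbb{R}^2$, $\lambda\in[M_0]$ (real-valued, square-integrable in $u$), to $x^{(L)}(u,\lambda)$, $u\in\mathbb{R}^2,\lambda\in[M_L]$, recursively for $l=1,\dots,L$ by $$x^{(l)}(u,\lambda)=\sigma\Big(\sum_{\lambda'=1}^{M_{l-1}}\int_{\mathbb{R}^2}W^{(l)}_{\lambda',\lambda}(v')\,x^{(l-1)}(u+v',\lambda')\,dv'+b^{(l)}(\lambda)\Big),$$ with real-valued compactly supported integrable filters $W^{(l)}_{\lambda',\lambda}:\mathbb{R}^2\to\mathbb{R}$ and biases $b^{(l)}(\lambda)\in\mathbb{R}$. The right-hand side defines the $l$-th layer mapping $x^{(l-1)}\mapsto x^{(l)}[x^{(l-1)}]$. Here $\|f\|_1=\int_{\mathbb{R}^2}|f(u)|du$. For a function $x(u,\lambda)$, $u\in\mathbb{R}^2$, $\lambda\in[M]$, the norm is $$\|x\|^2=\frac1M\sum_{\lambda\in[M]}\frac1{|\Omega|}\int_{\mathbb{R}^2}|x(u,\lambda)|^2du,$$ where $|\Omega|=(2\cdot2^J)^2$ is the area of the image-support domain $\Omega$, a fixed square of side $2\cdot 2^J$ (the same for all layers). The output $x_0^{(l)}$ of the $l$-th layer from the zero input $x^{(0)}\equiv0$ does not depend on $u$, and is therefore written $x_0^{(l)}(\lambda)$; in particular $x_0^{(0)}=0$. *)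

(* Defs.v *)
From HB Require Import structures.
From mathcomp Require Import all_boot all_order all_algebra.
From mathcomp Require Import all_classical all_reals all_analysis.
Import Order.TTheory GRing.Theory Num.Theory.
Import numFieldNormedType.Exports.

Set Implicit Arguments.
Unset Strict Implicit.
Unset Printing Implicit Defensive.

Local Open Scope classical_set_scope.
Local Open Scope ring_scope.

Definition leb2 (R : realType) :
    {measure set (measurableTypeR R * measurableTypeR R) -> \bar R} :=
  (@lebesgue_measure R \x @lebesgue_measure R)%E.

Definition non_expansive (R : realType) (sigma : R -> R) : Prop :=
  forall s t, `|sigma s - sigma t| <= `|s - t|.

Definition compactly_supported (R : realType) (f : R * R -> R) : Prop :=
  compact (closure [set v | f v != 0]).

(** Planar analogue of [locally_integrable], which the library only provides
    for functions on the line. *)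
Definition locally_integrable2 (R : realType) (f : R * R -> R) : Prop :=
  measurable_fun [set: measurableTypeR R * measurableTypeR R] f /\
  forall K : set (R * R), compact K ->
    (\int[@leb2 R]_(u in K) `|f u|%:E < +oo)%E.

(** Channels [1..m] are represented by ['I_m].  The integral is the total
    [Rintegral]: if [x] is locally integrable and the filters are integrable
    with compact support, the integrand is integrable for almost every [u];
    on the remaining null set of [u] the value is immaterial. *)
Definition layer (R : realType) (sigma : R -> R) (m n : nat)
    (W : 'I_m -> 'I_n -> R * R -> R) (b : 'I_n -> R)
    (x : R * R -> 'I_m -> R) : R * R -> 'I_n -> R :=
  fun u lam =>
    sigma (\sum_(lam' < m) \int[@leb2 R]_v (W lam' lam v * x (u + v) lam')
           + b lam).

(** [W l] and [b l] are the parameters of the layer mapping [x^(l)] to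
    [x^(l+1)]. *)
Fixpoint cnn (R : realType) (sigma : R -> R) (M : nat -> nat)
    (W : forall l, 'I_(M l) -> 'I_(M l.+1) -> R * R -> R)
    (b : forall l, 'I_(M l.+1) -> R)
    (x : R * R -> 'I_(M 0%N) -> R) (l : nat) : R * R -> 'I_(M l) -> R :=
  match l with
  | 0%N => x
  | k.+1 => layer sigma (W k) (b k) (@cnn R sigma M W b x k)
  end.
Arguments cnn {R} sigma {M} W b x l.

(** The response to the zero input is read off at the origin;
    [zero_responseE] shows that it does not depend on the position. *)
Definition zero_response (R : realType) (sigma : R -> R) (M : nat -> nat)
    (W : forall l, 'I_(M l) -> 'I_(M l.+1) -> R * R -> R)
    (b : forall l, 'I_(M l.+1) -> R) (l : nat) (lam : 'I_(M l)) : R :=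
  cnn sigma W b (fun _ _ => 0) l 0 lam.
Arguments zero_response {R} sigma {M} W b l.

Lemma zero_responseE (R : realType) (sigma : R -> R) (M : nat -> nat)
    (W : forall l, 'I_(M l) -> 'I_(M l.+1) -> R * R -> R)
    (b : forall l, 'I_(M l.+1) -> R) (l : nat) (u : R * R) (lam : 'I_(M l)) :
  cnn sigma W b (fun _ _ => 0) l u lam = zero_response sigma W b l lam.
Proof.
rewrite /zero_response; elim: l u lam => [//|l IHl] u lam /=.
rewrite /layer; congr (sigma (_ + _)); apply: eq_bigr => lam' _.
by apply: eq_Rintegral => v _; rewrite (IHl (u + v)) (IHl (0 + v)).
Qed.

Definition cnn_centered (R : realType) (sigma : R -> R) (M : nat -> nat)
    (W : forall l, 'I_(M l) -> 'I_(M l.+1) -> R * R -> R)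
    (b : forall l, 'I_(M l.+1) -> R)
    (x : R * R -> 'I_(M 0%N) -> R) (l : nat) : R * R -> 'I_(M l) -> R :=
  fun u lam => cnn sigma W b x l u lam - zero_response sigma W b l lam.
Arguments cnn_centered {R} sigma {M} W b x l.

Definition Omega_area (R : realType) (J : R) : R := (2 * 2 `^ J) ^+ 2.

(** The norm is extended-real valued: it is [+oo] on functions that are not
    square integrable. *)
Definition feature_norm (R : realType) (J : R) (m : nat)
    (x : R * R -> 'I_m -> R) : \bar R :=
  ((m%:R^-1)%:E * \sum_(lam < m)
     ((Omega_area J)^-1)%:E * \int[@leb2 R]_u (`|x u lam| ^+ 2)%:E)%E
  `^ 2^-1.

Definition L1norm (R : realType) (f : R * R -> R) : \bar R :=
  'N[@leb2 R]_1[EFin \o f]%E.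

(** The quantity [B] of a layer from [m] to [n] channels. *)
Definition filter_bound (R : realType) (m n : nat)
    (W : 'I_m -> 'I_n -> R * R -> R) : \bar R :=
  maxe
    (ereal_sup [set (\sum_(lam' < m) L1norm (W lam' lam))%E | lam in [set: 'I_n]])
    (ereal_sup [set ((m%:R / n%:R)%:E * \sum_(lam < n) L1norm (W lam' lam))%E
               | lam' in [set: 'I_m]]).

(* Main.v *)
Require Import Defs.
From HB Require Import structures.
From mathcomp Require Import all_boot all_order all_algebra.
From mathcomp Require Import all_classical all_reals all_analysis.
From mathcomp Require Import measurable_realfun.
Import Order.TTheory GRing.Theory Num.Theory.
Import numFieldNormedType.Exports.

Set Implicit Arguments.
Unset Strict Implicit.
Unset Printing Implicit Defensive.

Local Open Scope classical_set_scope.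
Local Open Scope ring_scope.

(** Write [d = x1 - x2].  Since [sigma] is non-expansive, the two outputs of a
    layer differ at almost every [u] by at most
    [s := \sum_lam' \int |W lam' lam v| |d (u + v) lam'| dv].  Integrating
    [2 s |d| <= s^2 + |d|^2] against the weights [|W|], whose total mass is at
    most [1] by the first half of the filter bound, gives
    [s^2 <= \sum_lam' \int |W lam' lam v| |d (u + v) lam'|^2 dv].  Integrating
    over [u] with Tonelli and translation invariance, and summing over [lam]
    with the second half of the filter bound, yields the estimate of the norms.
    Part (b) is the case where [x2] is the constant zero-input response. *)

Local Notation plane R := (measurableTypeR R * measurableTypeR R)%type.

(** * Translation invariance of Lebesgue measure on the line and the plane *)

(** By uniqueness of Lebesgue measure: its pushforward under the shift gives every half-open
    interval its length. *)
Lemma lebesgue_measure_shift (R : realType) (a : R)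
    (A : set (measurableTypeR R)) : measurable A ->
  lebesgue_measure ((fun u : R => u + a) @^-1` A) = lebesgue_measure A.
Proof.
have ma : measurable_fun [set: measurableTypeR R]
    ((fun u => u + a) : measurableTypeR R -> measurableTypeR R).
  exact: measurable_funD.
move=> mA; apply/esym.
pose mu := pushforward (@lebesgue_measure R)
  ((fun u => u + a) : measurableTypeR R -> measurableTypeR R).
apply: (@lebesgue_measure_unique R mu) => //= _ [[x y]] _ <-.
rewrite /mu/= /pushforward.
rewrite (_ : _ @^-1` _ = `]x - a, y - a]%classic); last first.
  by apply/seteqP; split => z /=; rewrite !in_itv/= ltrBlDr lerBrDr.
rewrite !lebesgue_measure_itv/= !lte_fin ltrD2r.
by case: ifP => // _; rewrite -!EFinD opprB addrA subrK.
Qed.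

Lemma measurable_shift (R : realType) (a : plane R) :
  measurable_fun [set: plane R] (fun u : plane R => ((u + a)%R : plane R)).
Proof.
apply/measurable_fun_pairP; split => /=.
  by apply: measurable_funD => //; exact: measurable_fst.
by apply: measurable_funD => //; exact: measurable_snd.
Qed.

Lemma measurable_shiftl (R : realType) (a : plane R) :
  measurable_fun [set: plane R] (fun u : plane R => ((a + u)%R : plane R)).
Proof. by under eq_fun do rewrite addrC; exact: measurable_shift. Qed.

(** By uniqueness of the product measure: a shift pulls a rectangle back to the rectangle of shifted
    sides, so the one-dimensional case applies to each factor. *)
Lemma leb2_shift (R : realType) (a : plane R) (A : set (plane R)) :
  measurable A ->
  leb2 R ((fun u : plane R => (u + a)%R : plane R) @^-1` A) = leb2 R A.
Proof.
move=> mA; apply/esym.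
pose mu := pushforward (leb2 R)
  ((fun u => u + a) : plane R -> plane R).
have ms := @measurable_shift R a.
apply: (@product_measure_unique _ _ _ _ _ _ _ mu) => // B C mB mC.
rewrite /mu/= /pushforward /leb2.
rewrite (_ : _ @^-1` _ = ((fun u : R => u + a.1) @^-1` B) `*`
  ((fun u : R => u + a.2) @^-1` C)); last by apply/seteqP; split.
have mf (b : R) : measurable_fun [set: measurableTypeR R]
    ((fun u => u + b) : measurableTypeR R -> measurableTypeR R).
  exact: measurable_funD.
rewrite product_measure1E//= ?lebesgue_measure_shift//.
- by rewrite -[X in measurable X]setTI; exact: mf.
- by rewrite -[X in measurable X]setTI; exact: mf.
Qed.

Lemma ge0_integral_shift (R : realType) (a : plane R) (f : plane R -> \bar R) :
  measurable_fun [set: plane R] f -> (forall u, (0 <= f u)%E) ->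
  (\int[leb2 R]_u f (u + a)%R = \int[leb2 R]_u f u)%E.
Proof.
move=> mf f0; have ms := @measurable_shift R a.
have /= E := ge0_integral_pushforward ms (leb2 R) measurableT mf
  (fun u _ => f0 u).
transitivity (\int[pushforward (leb2 R)
    (fun u : plane R => (u + a)%R : plane R)]_u f u)%E.
  exact: (esym E).
apply: eq_measure_integral => A mA _.
exact: leb2_shift.
Qed.

(** * Exhaustion of the plane by squares *)

(** Closed balls of the max norm: measurable, compact, of finite measure, and with radii that add up
    under sums of points. *)
Definition square (R : realType) (r : R) : set (plane R) :=
  `[- r, r]%classic `*` `[- r, r]%classic.

Lemma measurable_square (R : realType) (r : R) : measurable (square r).
Proof. by apply: measurableX; exact: measurable_itv. Qed.

Lemma in_squareP (R : realType) (r : R) (u : plane R) :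
  square r u <-> `|u.1| <= r /\ `|u.2| <= r.
Proof. by rewrite /square /= !in_itv/= -!ler_norml. Qed.

Lemma leb2_square_lty (R : realType) (r : R) : (leb2 R (square r) < +oo)%E.
Proof.
rewrite /leb2 /square/= product_measure1E; try exact: measurable_itv.
rewrite /= !lebesgue_measure_itv/=; case: ifP => _;
  by rewrite -?EFinB -?EFinM ?mule0 ?ltry.
Qed.

Lemma exists_square (R : realType) (u : plane R) :
  exists n : nat, square n%:R u.
Proof.
have m0 : 0 <= Num.max `|u.1| `|u.2| by rewrite le_max normr_ge0.
exists (Num.bound (Num.max `|u.1| `|u.2|)); apply/in_squareP.
have := ltW (archi_boundP m0).
by rewrite ge_max => /andP[].
Qed.

Lemma leb2_sigma_finite (R : realType) : sigma_finite setT (leb2 R).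
Proof.
exists (fun n => square n%:R).
  by apply/esym; rewrite -subTset => u _; have [n] := exists_square u; exists n.
by move=> n; split; [exact: measurable_square|exact: leb2_square_lty].
Qed.

(** The same measure as [leb2], bundled with its sigma-finiteness in the form that Tonelli's theorem
    asks for. *)
Definition sigma_finite_leb2 (R : realType) :
    {sigma_finite_measure set (plane R) -> \bar R} :=
  HB.pack (Measure.sort (leb2 R)) (Measure.class (leb2 R))
    (Measure_isSigmaFinite.Build _ _ _ (leb2 R) (@leb2_sigma_finite R)).

(** * Tonelli for correlation integrals *)

Lemma measurable_add (R : realType) :
  measurable_fun [set: plane R * plane R]
    (fun z : plane R * plane R => (z.1 + z.2)%R : plane R).
Proof.
have m1 : measurable_fun [set: plane R * plane R] fst by exact: measurable_fst.
have m2 : measurable_fun [set: plane R * plane R] snd by exact: measurable_snd.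
apply/measurable_fun_pairP; split => /=; apply: measurable_funD => /=.
- exact: (measurableT_comp measurable_fst m1).
- exact: (measurableT_comp measurable_fst m2).
- exact: (measurableT_comp measurable_snd m1).
- exact: (measurableT_comp measurable_snd m2).
Qed.

Lemma measurable_conv_kernel (R : realType) (w g : plane R -> \bar R) :
  measurable_fun [set: plane R] w -> measurable_fun [set: plane R] g ->
  measurable_fun [set: plane R * plane R]
    (fun z => w z.2 * g (z.1 + z.2)%R)%E.
Proof.
move=> mw mg; apply: emeasurable_funM.
  exact: (measurableT_comp mw measurable_snd).
exact: (measurableT_comp mg (@measurable_add R)).
Qed.

Lemma measurable_ge0_conv (R : realType) (w g : plane R -> \bar R) :
  measurable_fun [set: plane R] w -> measurable_fun [set: plane R] g ->
  (forall u, (0 <= w u)%E) -> (forall u, (0 <= g u)%E) ->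
  measurable_fun [set: plane R] (fun u => \int[leb2 R]_v (w v * g (u + v)%R))%E.
Proof.
move=> mw mg w0 g0.
have h0 (z : plane R * plane R) : (0 <= w z.2 * g (z.1 + z.2)%R)%E.
  by rewrite mule_ge0.
exact: (@measurable_fun_fubini_tonelli_F _ _ _ _ _ (sigma_finite_leb2 R)
  _ (measurable_conv_kernel mw mg) h0).
Qed.

(** After the integrals are swapped, the inner one is a shifted copy of the integral of [g]; by
    translation invariance it does not depend on [v] and factors out. *)
Lemma ge0_integral_conv (R : realType) (w g : plane R -> \bar R) :
  measurable_fun [set: plane R] w -> measurable_fun [set: plane R] g ->
  (forall u, (0 <= w u)%E) -> (forall u, (0 <= g u)%E) ->
  (\int[leb2 R]_u \int[leb2 R]_v (w v * g (u + v)%R)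
   = \int[leb2 R]_v w v * \int[leb2 R]_u g u)%E.
Proof.
move=> mw mg w0 g0.
have h0 (z : plane R * plane R) : (0 <= w z.2 * g (z.1 + z.2)%R)%E.
  by rewrite mule_ge0.
rewrite (@fubini_tonelli _ _ _ _ _ (sigma_finite_leb2 R) (sigma_finite_leb2 R)
  _ (measurable_conv_kernel mw mg) h0)/=.
under eq_integral => v _.
  rewrite (@ge0_integralZl _ _ _ (leb2 R))//; last 1 first.
    exact: (measurableT_comp mg (@measurable_shift R v)).
  rewrite ge0_integral_shift// muleC.
  over.
rewrite (@ge0_integralZl _ _ _ (leb2 R)) ?integral_ge0//.
by rewrite muleC.
Qed.

(** * A weighted mean-square inequality *)

(** Jensen's inequality for the square, with a weight of total mass at most [1] spread over [m]
    copies of the space. *)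
Lemma sqr_sum_Rintegral_le (d : measure_display) (T : measurableType d)
    (R : realType) (mu : {measure set T -> \bar R}) (m : nat)
    (w h : 'I_m -> T -> R) :
  (forall i, measurable_fun setT (w i)) ->
  (forall i, measurable_fun setT (h i)) ->
  (forall i, mu.-integrable setT (EFin \o (fun v => w i v * h i v))) ->
  (\sum_(i < m) \int[mu]_v `|w i v|%:E <= 1)%E ->
  ((`|\sum_(i < m) \int[mu]_v (w i v * h i v)| ^+ 2)%:E
   <= \sum_(i < m) \int[mu]_v (`|w i v| * `|h i v| ^+ 2)%:E)%E.
Proof.
move=> mw mh iwh w1.
have mnw i : measurable_fun setT (fun v => `|w i v|) by exact: measurableT_comp.
have mnh i : measurable_fun setT (fun v => `|h i v|) by exact: measurableT_comp.
pose s := \sum_(i < m) \int[mu]_v `|w i v * h i v|.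
have s0 : 0 <= s.
  by apply: sumr_ge0 => i _; apply: Rintegral_ge0.
have sE : s%:E = (\sum_(i < m) \int[mu]_v (`|w i v| * `|h i v|)%:E)%E.
  rewrite /s -sumEFin; apply: eq_bigr => i _.
  rewrite /Rintegral fineK; last first.
    by apply: integrable_fin_num => //; exact: (integrable_norm (iwh i)).
  by apply: eq_integral => v _; rewrite normrM.
apply: (@le_trans _ _ (s ^+ 2)%:E).
  rewrite lee_fin lerXn2r ?nnegrE//; apply: le_trans (ler_norm_sum _ _ _) _.
  by apply: ler_sum => i _; exact: (le_normr_Rintegral measurableT (iwh i)).
set Q := (X in (_ <= X)%E).
(* [Q] may be infinite; only the finite term [s ^+ 2] is cancelled. *)
suff : ((s ^+ 2)%:E + (s ^+ 2)%:E <= (s ^+ 2)%:E + Q)%E by rewrite leeD2lE.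
(* Integrate [2 s |h| <= s^2 + |h|^2] against the weights [|w|]. *)
have -> : ((s ^+ 2)%:E + (s ^+ 2)%:E
    = \sum_(i < m) (2 * s)%:E * \int[mu]_v (`|w i v| * `|h i v|)%:E)%E.
  rewrite -ge0_sume_distrr; last first.
    by move=> i _; apply: integral_ge0 => v _; rewrite lee_fin mulr_ge0.
  by rewrite -sE -EFinD -EFinM -mulr2n -mulrA -expr2 mulr_natl.
(* The mass bound [w1] enters here: the terms [s ^+ 2] times the masses add up to at most
   [s ^+ 2]. *)
apply: (@le_trans _ _ (\sum_(i < m) ((s ^+ 2)%:E * \int[mu]_v `|w i v|%:E
    + \int[mu]_v (`|w i v| * `|h i v| ^+ 2)%:E))%E); last first.
  rewrite big_split/= leeD2r// -ge0_sume_distrr; last first.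
    by move=> i _; apply: integral_ge0 => v _; rewrite lee_fin.
  by rewrite -[leRHS]mule1 lee_wpmul2l// lee_fin sqr_ge0.
apply: lee_sum => i _.
have mw1 : measurable_fun setT (EFin \o (fun v => `|w i v|)).
  exact/measurable_EFinP.
have mwh1 : measurable_fun setT (EFin \o (fun v => `|w i v| * `|h i v|)).
  by apply/measurable_EFinP; exact: measurable_funM.
have mwh2 : measurable_fun setT (EFin \o (fun v => `|w i v| * `|h i v| ^+ 2)).
  apply/measurable_EFinP; apply: measurable_funM => //.
  exact: measurable_funX.
rewrite -(ge0_integralZl_EFin mu measurableT _ mwh1) ?mulr_ge0//; last first.
  by move=> v _; rewrite lee_fin mulr_ge0.
rewrite -(ge0_integralZl_EFin mu measurableT _ mw1) ?sqr_ge0//; last first.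
  by move=> v _; rewrite lee_fin.
have mZ1 := measurable_funeM (s ^+ 2)%:E mw1.
rewrite -(ge0_integralD mu measurableT _ mZ1 _ mwh2); last 2 first.
- by move=> v _; rewrite -EFinM lee_fin mulr_ge0// sqr_ge0.
- by move=> v _; rewrite lee_fin mulr_ge0// sqr_ge0.
apply: ge0_le_integral => //.
- by move=> v _; rewrite -EFinM lee_fin !mulr_ge0.
- exact: measurable_funeM.
- exact: emeasurable_funD.
move=> v _; rewrite -!EFinM -EFinD lee_fin.
rewrite mulrCA [in leRHS]mulrC -mulrDr ler_wpM2l// -subr_ge0.
rewrite (_ : _ - _ = (s - `|h i v|) ^+ 2) ?sqr_ge0//.
by rewrite sqrrB mulr_natl mulrnAl addrAC.
Qed.

(** * Measurability of the layer outputs *)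

(** No slice of [k] is assumed integrable: the integral is the difference of those of the positive
    and negative parts, each measurable in [u] by Tonelli, and [fine] preserves measurability. *)
Lemma measurable_Rintegral_plane (R : realType) (k : plane R * plane R -> R) :
  measurable_fun [set: plane R * plane R] k ->
  measurable_fun [set: plane R] (fun u => \int[leb2 R]_v k (u, v)).
Proof.
move=> mk; rewrite /Rintegral.
have mek : measurable_fun [set: plane R * plane R] (EFin \o k).
  exact/measurable_EFinP.
apply: (measurableT_comp (fine_measurable measurableT)).
have f0 z : (0 <= ((EFin \o k)^\+ z))%E by exact: funepos_ge0.
have g0 z : (0 <= ((EFin \o k)^\- z))%E by exact: funeneg_ge0.
have mf := @measurable_fun_fubini_tonelli_F _ _ _ _ _ (sigma_finite_leb2 R)
  _ (measurable_funepos mek) f0.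
have mg := @measurable_fun_fubini_tonelli_F _ _ _ _ _ (sigma_finite_leb2 R)
  _ (measurable_funeneg mek) g0.
have := emeasurable_funB mf mg.
apply: eq_measurable_fun => u _; rewrite [RHS]integralE.
by congr (_ - _)%E; apply: eq_integral => v _; rewrite ?funeposE ?funenegE.
Qed.

Lemma non_expansive_measurable (R : realType) (sigma : R -> R) :
  non_expansive sigma -> measurable_fun [set: R] sigma.
Proof.
move=> sig; apply: continuous_measurable_fun => t.
apply/cvgrPdist_lt => e e0; near=> s.
apply: le_lt_trans (sig _ _) _.
by near: s; exact: cvgr_dist_lt.
Unshelve. all: by end_near. Qed.

Lemma measurable_layer (R : realType) (sigma : R -> R) (m n : nat)
    (W : 'I_m -> 'I_n -> R * R -> R) (b : 'I_n -> R)
    (x : R * R -> 'I_m -> R) (lam : 'I_n) :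
  non_expansive sigma ->
  (forall lam', measurable_fun [set: plane R] (W lam' lam)) ->
  (forall lam', measurable_fun [set: plane R] (fun u => x u lam')) ->
  measurable_fun [set: plane R] (fun u => layer sigma W b x u lam).
Proof.
move=> sig mW mx; rewrite /layer.
apply: (measurableT_comp (non_expansive_measurable sig)).
apply: measurable_funD => //; apply: measurable_sum => lam'.
apply: (@measurable_Rintegral_plane R
  (fun z => W lam' lam z.2 * x (z.1 + z.2)%R lam')).
apply: measurable_funM.
  exact: (measurableT_comp (mW lam') measurable_snd).
exact: (measurableT_comp (mx lam') (@measurable_add R)).
Qed.

(** * Almost everywhere convergence of the filter integrals *)

(** A local form of Young's inequality in L1. It makes the integrals in a layer genuine off a null
    set, so that linearity can be used there. *)
Lemma ae_integrable_conv (R : realType) (w x : plane R -> R) (r : nat) :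
  (leb2 R).-integrable setT (EFin \o w) ->
  (forall v, w v != 0 -> square r%:R v) ->
  measurable_fun [set: plane R] x ->
  (forall n : nat, (\int[leb2 R]_(u in square n%:R) `|x u|%:E < +oo)%E) ->
  \forall u \ae leb2 R,
    (leb2 R).-integrable setT (EFin \o (fun v => w v * x (u + v)%R)).
Proof.
move=> /integrableP[mw iw] wr mx ix.
pose a := fun v => `|(w v)%:E|%E.
(* Cutting [x] off outside a square makes the convolution with [|w|] integrable
   over the whole plane; for [u] in the square of radius [n], cutting off at
   radius [n + r] changes nothing. *)
pose g n := (fun u => `|x u|%:E) \_ (@square R n%:R).
have ma : measurable_fun [set: plane R] a by exact: measurableT_comp.
have a0 v : (0 <= a v)%E by exact: abse_ge0.
have mnx : measurable_fun [set: plane R] (fun u => `|x u|%:E).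
  by apply/measurable_EFinP; exact: measurableT_comp.
have mg n : measurable_fun [set: plane R] (g n).
  apply/(measurable_restrictT _ (measurable_square _)).
  exact: measurable_funTS.
have g0 n u : (0 <= g n u)%E by apply: erestrict_ge0 => v _; rewrite lee_fin.
(* By Tonelli the integral over [u] is the L1 norm of [w] times the integral of [|x|] over a square,
   hence finite; so the integrand is finite almost everywhere. *)
have ae_fin n : \forall u \ae leb2 R,
    (\int[leb2 R]_v (a v * g n (u + v)%R) < +oo)%E.
  have ig : (leb2 R).-integrable setT
      (fun u => \int[leb2 R]_v (a v * g n (u + v)%R))%E.
    apply/integrableP; split; first exact: measurable_ge0_conv.
    under eq_integral => u _.
      rewrite gee0_abs; last by apply: integral_ge0 => v _; rewrite mule_ge0.
      over.
    rewrite ge0_integral_conv// lte_mul_pinfty ?integral_ge0//.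
      by rewrite ge0_fin_numE// integral_ge0.
    by rewrite /g -integral_mkcond.
  apply: filterS (integrable_ae measurableT ig) => u /(_ I) fu.
  by rewrite ltey_eq fu.
(* The countably many exceptional null sets are merged first, since the cut-off radius is chosen
   depending on [u]. *)
apply: filterS (ae_foralln ae_fin) => u fu.
have mu : measurable_fun [set: plane R] (fun v => w v * x (u + v)%R).
  apply: measurable_funM; first exact/measurable_EFinP.
  exact: (measurableT_comp mx (measurable_shiftl u)).
apply/integrableP; split; first exact/measurable_EFinP.
have [n un] := exists_square u.
apply: le_lt_trans (fu (n + r)%N).
apply: ge0_le_integral => //.
- by apply: measurableT_comp => //; exact/measurable_EFinP.
- apply: emeasurable_funM => //.
  exact: (measurableT_comp (mg _) (measurable_shiftl u)).
move=> v _; rewrite /a/= normrM EFinM.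
have [->|wv0] := eqVneq (w v) 0; first by rewrite normr0 !mul0e.
rewrite lee_wpmul2l//; suff uv : square (n + r)%:R (u + v).
  by rewrite /g patchT ?inE.
have [/in_squareP[u1 u2] /in_squareP[v1 v2]] := (un, wr _ wv0).
by apply/in_squareP; split; rewrite natrD (le_trans (ler_normD _ _))// lerD.
Qed.

Lemma compactly_supported_square (R : realType) (f : plane R -> R) :
  compactly_supported f ->
  exists n : nat, forall v, f v != 0 -> square n%:R v.
Proof.
move=> /compact_bounded[r [_ fr]].
(* The bound holds only for reals strictly above [r], hence the [+ 1]; the absolute value provides
   the nonnegativity needed by [Num.bound]. *)
have r1 : r < `|r| + 1.
  by rewrite (le_lt_trans (ler_norm r))// ltrDl.
exists (Num.bound (`|r| + 1)) => v fv.
have vr : `|v : R * R| <= `|r| + 1.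
  by apply: (fr _ r1); exact: subset_closure.
have rb : `|r| + 1 <= (Num.bound (`|r| + 1))%:R.
  by rewrite ltW// archi_boundP// addr_ge0.
apply/in_squareP; have := le_trans vr rb.
by rewrite prod_normE ge_max => /andP[].
Qed.

(** * Energies, norms and the layer estimate *)

(** The squared norm freed of the channel and area factors, so that filter bounds act on it
    linearly. *)
Definition energy (R : realType) (m : nat) (x : R * R -> 'I_m -> R) : \bar R :=
  (\sum_(i < m) \int[leb2 R]_u (`|x u i| ^+ 2)%:E)%E.

Lemma energy_ge0 (R : realType) (m : nat) (x : R * R -> 'I_m -> R) :
  (0 <= energy x)%E.
Proof.
by apply: sume_ge0 => i _; apply: integral_ge0 => u _; rewrite lee_fin sqr_ge0.
Qed.

(** The area factor is common to both sides, and the square root is monotone on the nonnegative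
    extended reals. *)
Lemma feature_norm_le (R : realType) (J : R) (m n : nat)
    (x : R * R -> 'I_m -> R) (y : R * R -> 'I_n -> R) :
  ((n%:R^-1)%:E * energy y <= (m%:R^-1)%:E * energy x)%E ->
  (feature_norm J y <= feature_norm J x)%E.
Proof.
have int0 k (z : R * R -> 'I_k -> R) i :
    (0 <= \int[leb2 R]_u (`|z u i| ^+ 2)%:E)%E.
  by apply: integral_ge0 => u _; rewrite lee_fin sqr_ge0.
have a0 : 0 <= (Omega_area J)^-1 by rewrite invr_ge0 sqr_ge0.
have pull k (z : R * R -> 'I_k -> R) : ((k%:R^-1)%:E * \sum_(i < k)
    ((Omega_area J)^-1)%:E * \int[leb2 R]_u (`|z u i| ^+ 2)%:E
    = ((Omega_area J)^-1)%:E * ((k%:R^-1)%:E * energy z))%E.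
  by rewrite -ge0_sume_distrr// muleCA.
have ge0 k (z : R * R -> 'I_k -> R) :
    (0 <= ((Omega_area J)^-1)%:E * ((k%:R^-1)%:E * energy z))%E.
  by rewrite !mule_ge0 ?lee_fin ?invr_ge0 ?ler0n ?sqr_ge0 ?energy_ge0.
move=> yx; rewrite /feature_norm !pull; apply: gt0_ler_poweR.
- by rewrite invr_ge0.
- by rewrite in_itv/= ge0 leey.
- by rewrite in_itv/= ge0 leey.
- exact: lee_wpmul2l.
Qed.

Lemma filter_bound_le1 (R : realType) (m n : nat)
    (W : 'I_m -> 'I_n -> R * R -> R) : (filter_bound W <= 1)%E ->
  (forall lam, (\sum_(lam' < m) L1norm (W lam' lam) <= 1)%E) /\
  (forall lam', ((m%:R / n%:R)%:E * \sum_(lam < n) L1norm (W lam' lam) <= 1)%E).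
Proof.
rewrite /filter_bound ge_max => /andP[le1 le2]; split => i.
  by apply: le_trans le1; apply: ereal_sup_ubound; exists i.
by apply: le_trans le2; apply: ereal_sup_ubound; exists i.
Qed.

(* The Schur test at the level of squares: one family of bounds controls the
   pointwise estimate, the other its integral over the plane. *)
Lemma layer_energy_le (R : realType) (sigma : R -> R) (m n : nat)
    (W : 'I_m -> 'I_n -> R * R -> R) (b : 'I_n -> R)
    (x1 x2 : R * R -> 'I_m -> R) :
  (0 < m)%N -> (0 < n)%N -> non_expansive sigma ->
  (forall lam' lam, compactly_supported (W lam' lam)) ->
  (forall lam' lam, (leb2 R).-integrable setT (EFin \o W lam' lam)) ->
  (filter_bound W <= 1)%E ->
  (forall lam, measurable_fun [set: plane R] (fun u => x1 u lam)) ->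
  (forall lam, measurable_fun [set: plane R] (fun u => x2 u lam)) ->
  (forall lam (k : nat),
     (\int[leb2 R]_(u in square k%:R) `|x1 u lam|%:E < +oo)%E) ->
  (forall lam (k : nat),
     (\int[leb2 R]_(u in square k%:R) `|x2 u lam|%:E < +oo)%E) ->
  ((n%:R^-1)%:E * energy (fun u lam => layer sigma W b x1 u lam
                                       - layer sigma W b x2 u lam)%R
   <= (m%:R^-1)%:E * energy (fun u lam => x1 u lam - x2 u lam)%R)%E.
Proof.
move=> m0 n0 sig Wsupp Wint /filter_bound_le1[bcol brow] mx1 mx2 ix1 ix2.
have mW i j : measurable_fun [set: plane R] (W i j).
  by have /integrableP[/measurable_EFinP] := Wint i j.
pose D i := fun u : plane R => `|x1 u i - x2 u i| ^+ 2.
have mD i : measurable_fun [set: plane R] (D i).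
  apply: measurable_funX; apply: measurableT_comp => //.
  exact: measurable_funB.
have D0 i u : (0 <= (D i u)%:E)%E by rewrite lee_fin sqr_ge0.
have W0 i j u : (0 <= `|W i j u|%:E)%E by rewrite lee_fin.
have mnW i j : measurable_fun [set: plane R] (fun u => `|W i j u|%:E).
  by apply/measurable_EFinP; exact: measurableT_comp.
have mED i : measurable_fun [set: plane R] (fun u => (D i u)%:E).
  exact/measurable_EFinP.
have L1E i j : L1norm (W i j) = (\int[leb2 R]_v `|W i j v|%:E)%E.
  exact: Lnorm1.
have L10 i j : (0 <= L1norm (W i j))%E by rewrite L1E integral_ge0.
pose F i j := fun u => (\int[leb2 R]_v (`|W i j v|%:E * (D i (u + v)%R)%:E))%E.
have F0 i j u : (0 <= F i j u)%E.
  by apply: integral_ge0 => v _; rewrite mule_ge0.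
have mF i j : measurable_fun [set: plane R] (F i j).
  exact: (measurable_ge0_conv (mnW i j) (mED i) (W0 i j) (D0 i)).
have channel j : (\int[leb2 R]_u (`|layer sigma W b x1 u j
      - layer sigma W b x2 u j| ^+ 2)%:E
    <= \sum_(i < m) L1norm (W i j) * \int[leb2 R]_u (D i u)%:E)%E.
  have -> : (\sum_(i < m) L1norm (W i j) * \int[leb2 R]_u (D i u)%:E
      = \int[leb2 R]_u \sum_(i < m) F i j u)%E.
    rewrite ge0_integral_sum//; apply: eq_bigr => i _.
    by rewrite L1E (ge0_integral_conv (mnW i j) (mED i) (W0 i j) (D0 i)).
  (* The pointwise estimate is made only where all filter integrals converge absolutely, which is
     enough for comparing integrals over [u]. *)
  have ae1 : \forall u \ae leb2 R, forall i, (leb2 R).-integrable setT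
      (EFin \o (fun v => W i j v * x1 (u + v)%R i)).
    apply: filter_forall => i.
    have [r Wr] := compactly_supported_square (Wsupp i j).
    exact: ae_integrable_conv (Wint i j) Wr (mx1 i) (ix1 i).
  have ae2 : \forall u \ae leb2 R, forall i, (leb2 R).-integrable setT
      (EFin \o (fun v => W i j v * x2 (u + v)%R i)).
    apply: filter_forall => i.
    have [r Wr] := compactly_supported_square (Wsupp i j).
    exact: ae_integrable_conv (Wint i j) Wr (mx2 i) (ix2 i).
  apply: ae_ge0_le_integral => //.
  - apply/measurable_EFinP; apply: measurable_funX.
    by apply: measurableT_comp => //; apply: measurable_funB;
      exact: measurable_layer.
  - by move=> u _; exact: sume_ge0.
  - exact: emeasurable_sum.
  have FF : Filter (nbhs (almost_everywhere (leb2 R))).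
    exact: ae_filter_ringOfSetsType.
  apply: filterS (filterI ae1 ae2) => u [i1 i2] _.
  have iB i : (leb2 R).-integrable setT
      (EFin \o (fun v => W i j v * (x1 (u + v)%R i - x2 (u + v)%R i))).
    have := integrableB measurableT (i1 i) (i2 i).
    by under eq_fun do rewrite /= -EFinB -mulrBr.
  have mh i : measurable_fun [set: plane R]
      (fun v => x1 (u + v)%R i - x2 (u + v)%R i).
    by apply: measurable_funB; [apply: (measurableT_comp (mx1 i))
      |apply: (measurableT_comp (mx2 i))]; exact: measurable_shiftl.
  have w1 : (\sum_(i < m) \int[leb2 R]_v `|W i j v|%:E <= 1)%E.
    by under eq_bigr do rewrite -L1E; exact: bcol.
  have := sqr_sum_Rintegral_le (fun i => mW i j) mh iB w1.
  apply: le_trans; rewrite lee_fin lerXn2r ?nnegrE//.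
  (* The biases cancel, and linearity leaves the filters applied to [x1 - x2]. *)
  apply: le_trans (sig _ _) _; rewrite opprD addrACA subrr addr0 -sumrB.
  rewrite (eq_bigr (fun i => \int[leb2 R]_v
    (W i j v * (x1 (u + v)%R i - x2 (u + v)%R i))))// => i _.
  rewrite -RintegralB//.
  by apply: eq_Rintegral => v _; rewrite mulrBr.
have energy_le : (energy (fun u j => layer sigma W b x1 u j
      - layer sigma W b x2 u j)%R
    <= \sum_(i < m)
      (\sum_(j < n) L1norm (W i j)) * \int[leb2 R]_u (D i u)%:E)%E.
  apply: (@le_trans _ _ (\sum_(j < n) \sum_(i < m)
      L1norm (W i j) * \int[leb2 R]_u (D i u)%:E)%E).
    by apply: lee_sum => j _; exact: channel.
  (* The exchange collects the filters that leave one input channel, as in the second half of the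
     filter bound. *)
  rewrite exchange_big/=; apply: lee_sum => i _.
  by rewrite ge0_sume_distrl.
have n0' : 0 < n%:R :> R by rewrite ltr0n.
have m0' : 0 < m%:R :> R by rewrite ltr0n.
apply: (@le_trans _ _ ((n%:R^-1)%:E * \sum_(i < m)
  (\sum_(j < n) L1norm (W i j)) * \int[leb2 R]_u (D i u)%:E)%E).
  by rewrite lee_wpmul2l// lee_fin invr_ge0 ltW.
rewrite /energy !ge0_sume_distrr//; last 2 first.
- by move=> i _; rewrite integral_ge0.
- by move=> i _; rewrite mule_ge0 ?integral_ge0 ?sume_ge0.
apply: lee_sum => i _; rewrite muleA lee_wpmul2r ?integral_ge0//.
(* This splits off the factor [m / n] carried by [brow]. *)
rewrite (_ : n%:R^-1 = m%:R^-1 * (m%:R / n%:R)); last first.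
  by rewrite mulKf// gt_eqF.
by rewrite EFinM -muleA -[leRHS]mule1 lee_wpmul2l// lee_fin invr_ge0 ltW.
Qed.

(** * Local integrability of the responses *)

Lemma locally_integrable2_on_square (R : realType) (f : plane R -> R)
    (k : nat) :
  locally_integrable2 f -> (\int[leb2 R]_(u in square k%:R) `|f u|%:E < +oo)%E.
Proof.
by move=> [_]; apply; apply: compact_setX; exact: segment_compact.
Qed.

(** Only the centered response is known to be square integrable. With [t <= 1 + t ^+ 2] one gets
    [|f| <= |c| + 1 + |f - c| ^+ 2], and constants are integrable on squares. *)
Lemma square_integrable_on_square (R : realType) (f : plane R -> R) (c : R)
    (k : nat) :
  measurable_fun [set: plane R] f ->
  (\int[leb2 R]_u (`|f u - c| ^+ 2)%:E < +oo)%E ->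
  (\int[leb2 R]_(u in square k%:R) `|f u|%:E < +oo)%E.
Proof.
move=> mf f2; have msq := @measurable_square R k%:R.
have mfc : measurable_fun [set: plane R] (fun u => (`|f u - c| ^+ 2)%:E).
  apply/measurable_EFinP; apply: measurable_funX; apply: measurableT_comp => //.
  exact: measurable_funB.
have mfs := measurable_funTS mfc (D := square k%:R).
have c0 : 0 <= `|c| + 1 by rewrite addr_ge0.
apply: (@le_lt_trans _ _ (\int[leb2 R]_(u in square k%:R)
  ((`|c| + 1)%:E + (`|f u - c| ^+ 2)%:E))%E).
  apply: ge0_le_integral => //.
  - apply/measurable_EFinP; apply: measurableT_comp => //.
    exact: measurable_funTS.
  - exact: emeasurable_funD.
  move=> u _; rewrite -EFinD lee_fin.
  have fu : `|f u| <= `|f u - c| + `|c|.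
    by rewrite -[X in `|X| <= _](subrK c) ler_normD.
  apply: le_trans fu _; rewrite addrC -addrA lerD2l.
  have [le1|/ltW ge1] := leP `|f u - c| 1.
    by rewrite ler_wpDr ?sqr_ge0.
  by rewrite ler_wpDl// expr2 ler_peMl.
rewrite ge0_integralD//= integral_cst// lte_add_pinfty//.
  by rewrite lte_mul_pinfty ?lee_fin// leb2_square_lty.
by apply: le_lt_trans f2; exact: ge0_subset_integral.
Qed.

(** * Centered responses through the network *)

(** Puts the centered output in the form of a difference of two images under one layer, the second
    of a constant input, to which the layer estimate applies. *)
Lemma cnn_centered_step (R : realType) (sigma : R -> R) (M : nat -> nat)
    (W : forall l, 'I_(M l) -> 'I_(M l.+1) -> R * R -> R)
    (b : forall l, 'I_(M l.+1) -> R) (x : R * R -> 'I_(M 0%N) -> R) (l : nat) :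
  cnn_centered sigma W b x l.+1 = (fun u lam =>
    layer sigma (W l) (b l) (cnn sigma W b x l) u lam -
    layer sigma (W l) (b l) (fun _ lam => zero_response sigma W b l lam) u lam).
Proof.
have zeroE : cnn sigma W b (fun _ _ => 0) l =
    (fun _ lam => zero_response sigma W b l lam).
  by apply/funext => u; apply/funext => lam; rewrite zero_responseE.
apply/funext => u; apply/funext => lam.
by rewrite /cnn_centered -(zero_responseE _ _ _ u)/= zeroE.
Qed.

Theorem proposition3p1 (R : realType) (J : R) (L : nat) (M : nat -> nat)
    (sigma : R -> R)
    (W : forall l : nat, 'I_(M l) -> 'I_(M l.+1) -> R * R -> R)
    (b : forall l : nat, 'I_(M l.+1) -> R)
    (M_gt0 : forall l : nat, (l <= L)%N -> (0 < M l)%N)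
    (sigma_nonexp : non_expansive sigma)
    (W_supp : forall l : nat, (l < L)%N ->
       forall lam' lam, compactly_supported (W l lam' lam))
    (W_int : forall l : nat, (l < L)%N ->
       forall lam' lam, (leb2 R).-integrable setT (EFin \o W l lam' lam))
    (W_bound : forall l : nat, (l < L)%N -> (filter_bound (W l) <= 1)%E) :
  (forall l : nat, (l < L)%N ->
     forall x1 x2 : R * R -> 'I_(M l) -> R,
       (forall lam, locally_integrable2 (fun u => x1 u lam)) ->
       (forall lam, locally_integrable2 (fun u => x2 u lam)) ->
       (feature_norm J (fun u lam => (layer sigma (W l) (b l) x1 u lam
                                     - layer sigma (W l) (b l) x2 u lam)%R)
        <= feature_norm J (fun u lam => (x1 u lam - x2 u lam)%R))%E) /\
  (forall x : R * R -> 'I_(M 0%N) -> R,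
     (forall lam, (fun u => x u lam) \in Lfun (leb2 R) 2%:E) ->
     [/\ forall l : nat, (l < L)%N ->
           (feature_norm J (cnn_centered sigma W b x l.+1)
            <= feature_norm J (cnn_centered sigma W b x l))%E,
         forall l : nat, (l <= L)%N ->
           (feature_norm J (cnn_centered sigma W b x l)
            <= feature_norm J (cnn_centered sigma W b x 0))%E
       & feature_norm J (cnn_centered sigma W b x 0)
         = feature_norm J x]).
Proof.
split=> [l lL x1 x2 x1loc x2loc|x xL2].
  apply: feature_norm_le; apply: layer_energy_le => //.
  - exact/M_gt0/ltnW.
  - exact: M_gt0.
  - exact: W_supp.
  - exact: W_int.
  - exact: W_bound.
  - by move=> lam; have [] := x1loc lam.
  - by move=> lam; have [] := x2loc lam.
  - by move=> lam k; exact: locally_integrable2_on_square.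
  - by move=> lam k; exact: locally_integrable2_on_square.
have centered0 : cnn_centered sigma W b x 0 = x.
  by apply/funext => u; apply/funext => lam; rewrite /cnn_centered /= subr0.
have mcnn l : (l <= L)%N -> forall lam,
    measurable_fun [set: plane R] (fun u => cnn sigma W b x l u lam).
  elim: l => [_ lam|l IHl lL lam].
    by have /andP[/=] := xL2 lam; rewrite inE.
  apply: measurable_layer => // lam'; last exact: (IHl (ltnW lL)).
  by have /integrableP[/measurable_EFinP] := W_int _ lL lam' lam.
(* Finite energy is a premise because local integrability of the layer's input is derived from it;
   [energy_fin] supplies it by induction, using [step] itself. *)
have step l : (l < L)%N -> (energy (cnn_centered sigma W b x l) < +oo)%E ->
    (((M l.+1)%:R^-1)%:E * energy (cnn_centered sigma W b x l.+1)
     <= ((M l)%:R^-1)%:E * energy (cnn_centered sigma W b x l))%E.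
  move=> lL fin; rewrite cnn_centered_step; apply: layer_energy_le => //.
  - exact/M_gt0/ltnW.
  - exact: M_gt0.
  - exact: W_supp.
  - exact: W_int.
  - exact: W_bound.
  - exact: (mcnn _ (ltnW lL)).
  - move=> lam k.
    apply: (@square_integrable_on_square _ _ (zero_response sigma W b l lam)).
      exact: (mcnn _ (ltnW lL)).
    apply: le_lt_trans fin; rewrite /energy (bigD1 lam)//= leeDl//.
    apply: sume_ge0 => i _; apply: integral_ge0 => u _.
    by rewrite lee_fin sqr_ge0.
  - move=> lam k; rewrite integral_cst; last exact: measurable_square.
    by rewrite lte_mul_pinfty ?lee_fin// leb2_square_lty.
have energy_fin l : (l <= L)%N -> (energy (cnn_centered sigma W b x l) < +oo)%E.
  elim: l => [_|l IHl lL].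
    rewrite centered0 /energy lte_sum_pinfty// => lam _.
    have /integrableP[_] := Lfun2_integrable_sqr (xL2 lam).
    apply: le_lt_trans; rewrite le_eqVlt; apply/orP; left; apply/eqP.
    by apply: eq_integral => u _ /=; rewrite normrX.
  have fin := IHl (ltnW lL).
  have M0 : 0 < ((M l.+1)%:R : R) by rewrite ltr0n M_gt0.
  (* Both sides are scaled by the positive factor of [step], which leaves [+oo] unchanged. *)
  rewrite -(@lte_pmul2l _ ((M l.+1)%:R^-1)%:E) ?lte_fin ?invr_gt0//.
  rewrite [ltRHS]gt0_muley ?lte_fin ?invr_gt0//.
  apply: le_lt_trans (step _ lL fin) _.
  by rewrite lte_mul_pinfty// lee_fin invr_ge0.
have norm_step l : (l < L)%N -> (feature_norm J (cnn_centered sigma W b x l.+1)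
    <= feature_norm J (cnn_centered sigma W b x l))%E.
  move=> lL; apply: feature_norm_le; apply: step => //.
  exact/energy_fin/ltnW.
split=> //; last by rewrite centered0.
elim=> [//|l IHl] lL; apply: le_trans (norm_step _ lL) _.
exact/IHl/ltnW.
Qed.
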